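(* Let $\sigma\ge0$ be a constant, $s\in\mathbb{C}$ with $\Re s>0$, $S_x=1+\sigma/s$, and $\theta=1$. Consider the Laplace transformed constant coefficient semi-discrete PML $$s^2\widehat{\mathbf{E}}_z=-(P_x^{-1}D_x^T\otimes I_y)(P_x\otimes I_y)\left((D_x\otimes I_y)\widehat{\mathbf{E}}_z+\sigma\widehat{\mathbf{H}}_y\right)-(I_x\otimes P_y^{-1}D_y^T)(I_x\otimes P_y)\left((I_x\otimes D_y)\widehat{\mathbf{E}}_z+\sigma\widehat{\mathbf{H}}_x\right)-\sigma s\widehat{\mathbf{E}}_z$$ $$\qquad+\sigma(1-\theta)(I_x\otimes P_y^{-1}B_y^-)\widehat{\mathbf{H}}_x-\left(P_x^{-1}B_x^+\otimes I_y+I_x\otimes P_y^{-1}B_y^+\right)s\widehat{\mathbf{E}}_z-\sigma\theta(I_x\otimes P_y^{-1}B_y^+)\widehat{\mathbf{E}}_z,$$ $$s\widehat{\mathbf{H}}_y=-(D_x\otimes I_y)\widehat{\mathbf{E}}_z-\sigma\widehat{\mathbf{H}}_y,\qquad s\widehat{\mathbf{H}}_x=(I_x\otimes D_y)\widehat{\mathbf{E}}_z.$$ All solutions satisfy the energy equation $\widehat{\mathcal{E}}^{(1)}_{h\sigma}(s)=0$, where $$\widehat{\mathcal{E}}^{(1)}_{h\sigma}(s)=\Re s\,|s|^2\,\widehat{\mathbf{E}}_z^*\mathbf{P}_{xy}\widehat{\mathbf{E}}_z+\frac{1}{|S_x|^2}\Re\left(\frac{(sS_x)^*}{S_x}\right)\left((D_x\otimes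 I_y)\widehat{\mathbf{E}}_z\right)^*\mathbf{P}_{xy}\left((D_x\otimes I_y)\widehat{\mathbf{E}}_z\right)+\Re s\left((I_x\otimes D_y)\widehat{\mathbf{E}}_z\right)^*\mathbf{P}_{xy}\left((I_x\otimes D_y)\widehat{\mathbf{E}}_z\right)$$ $$\qquad+|s|^2\Re\left(\frac{1}{S_x}\right)\widehat{\mathbf{E}}_z^*\left(B_x^+\otimes P_y+P_x\otimes B_y^+\right)\widehat{\mathbf{E}}_z+\theta\sigma\Re\left(\frac{s^*}{S_x}\right)\widehat{\mathbf{E}}_z^*\left(P_x\otimes B_y^+\right)\widehat{\mathbf{E}}_z.$$
   Context: Summation-by-parts (SBP) operators: for $\xi\in\{x,y\}$, $N_\xi\ge2$ is the number of grid points, $I_\xi$ the $N_\xi\times N_\xi$ identity, and $D_\xi=P_\xi^{-1}Q_\xi$ is a real $N_\xi\times N_\xi$ matrix (approximating $\partial/\partial\xi$) with $P_\xi$ diagonal and positive definite and $Q_\xi+Q_\xi^T=E_{R\xi}-E_{L\xi}$, where $E_{L\xi}=\mathrm{diag}(1,0,\dots,0)$, $E_{R\xi}=\mathrm{diag}(0,\dots,0,1)$. Write $B_\xi^{\pm}=E_{R\xi}\pm E_{L\xi}$. $\otimes$ is the Kronecker product and $\mathbf{P}_{xy}=P_x\otimes P_y$. The unknowns $\widehat{\mathbf{E}}_z,\widehat{\mathbf{H}}_y,\widehat{\mathbf{H}}_x$ are vectors in $\mathbb{C}^{N_xN_y}$. The superscript $^*$ denotes complex conjugation of scalars and conjugate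 transpose of vectors. *)

(* Defs.v *)
From HB Require Import structures.
From mathcomp Require Import all_boot all_order all_algebra.
From mathcomp Require Import spectral.
From mathcomp Require Import reals.
From mathcomp Require Import complex mxtens.

Set Implicit Arguments.
Unset Strict Implicit.
Unset Printing Implicit Defensive.

Import Order.TTheory GRing.Theory Num.Theory.

Local Open Scope ring_scope.
Local Open Scope sesquilinear_scope.

Section SBP.
Variables (R : realType) (n : nat).

Definition EL : 'M[R]_n := diag_mx (\row_(i < n) ((i : nat) == 0%N)%:R).
Definition ER : 'M[R]_n := diag_mx (\row_(i < n) ((i : nat) == n.-1)%:R).
Definition Bplus : 'M[R]_n := ER + EL.
Definition Bminus : 'M[R]_n := ER - EL.

(* Symmetry is not included: this is only used for diagonal matrices. *)
Definition pos_def (P : 'M[R]_n) : Prop :=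
  forall v : 'cV[R]_n, v != 0 -> 0 < (v^T *m P *m v) 0 0.

Record sbp_operator (P Q D : 'M[R]_n) : Prop := SBPOperator {
  sbp_diag : is_diag_mx P;
  sbp_pos_def : pos_def P;
  sbp_parts : Q + Q^T = ER - EL;
  sbp_diffE : D = invmx P *m Q
}.

End SBP.

Arguments EL {R n}.
Arguments ER {R n}.
Arguments Bplus {R n}.
Arguments Bminus {R n}.

Section PML.
Variables (R : realType) (Nx Ny : nat).
Variables (Px Dx : 'M[R]_Nx) (Py Dy : 'M[R]_Ny).
Variables (sigma theta : R) (s : R[i]).

Local Notation C := R[i].
Local Notation cplx := (real_complex R).

(* The real Kronecker product A (x) B, acting on complex grid functions;
   the grid point (i, j) has index i * Ny + j. *)
Definition kron (A : 'M[R]_Nx) (B : 'M[R]_Ny) : 'M[C]_(Nx * Ny) :=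
  map_mx cplx (A *t B).

Local Notation "A ⊗ B" := (kron A B) (at level 40, left associativity).
Local Notation Ix := (1%:M : 'M[R]_Nx).
Local Notation Iy := (1%:M : 'M[R]_Ny).
Local Notation sg := (cplx sigma).
Local Notation th := (cplx theta).

Definition Sx : C := 1 + sg / s.

Record pml_solution (Ez Hy Hx : 'cV[C]_(Nx * Ny)) : Prop := PMLSolution {
  pml_Ez :
    s ^+ 2 *: Ez =
      - (((invmx Px *m Dx^T) ⊗ Iy) *m (Px ⊗ Iy)
           *m ((Dx ⊗ Iy) *m Ez + sg *: Hy))
      - ((Ix ⊗ (invmx Py *m Dy^T)) *m (Ix ⊗ Py)
           *m ((Ix ⊗ Dy) *m Ez + sg *: Hx))
      - (sg * s) *: Ez
      + (sg * (1 - th)) *: ((Ix ⊗ (invmx Py *m Bminus)) *m Hx)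
      - (((invmx Px *m Bplus) ⊗ Iy) + (Ix ⊗ (invmx Py *m Bplus))) *m (s *: Ez)
      - (sg * th) *: ((Ix ⊗ (invmx Py *m Bplus)) *m Ez);
  pml_Hy : s *: Hy = - ((Dx ⊗ Iy) *m Ez) - sg *: Hy;
  pml_Hx : s *: Hx = (Ix ⊗ Dy) *m Ez
}.

Definition qform (M : 'M[C]_(Nx * Ny)) (u : 'cV[C]_(Nx * Ny)) : C :=
  (u ^t* *m M *m u) 0 0.

Definition pml_energy (Ez : 'cV[C]_(Nx * Ny)) : C :=
  let Pxy := Px ⊗ Py in
  'Re s * `|s| ^+ 2 * qform Pxy Ez
  + (`|Sx| ^+ 2)^-1 * 'Re ((s * Sx)^* / Sx) * qform Pxy ((Dx ⊗ Iy) *m Ez)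
  + 'Re s * qform Pxy ((Ix ⊗ Dy) *m Ez)
  + `|s| ^+ 2 * 'Re (Sx^-1) * qform ((Bplus ⊗ Py) + (Px ⊗ Bplus)) Ez
  + th * sg * 'Re (s^* / Sx) * qform (Px ⊗ Bplus) Ez.

End PML.

(* Main.v *)
Require Import Defs.
From mathcomp Require Import all_boot all_order all_algebra.
From mathcomp Require Import spectral reals complex mxtens.
From mathcomp Require Import ring.

Set Implicit Arguments.
Unset Strict Implicit.
Unset Printing Implicit Defensive.

Import Order.TTheory GRing.Theory Num.Theory.
Local Open Scope ring_scope.
Local Open Scope sesquilinear_scope.

(** The energy equation is the electric field equation tested with [Ez]
    itself, scaled by a factor that aligns the real parts.
    Solving the two auxiliary equations for the magnetic fields turns the fluxes into plain rescalings of the discrete gradient: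
    [Dx Ez + sigma Hy = Sx^-1 Dx Ez] ([pml_flux_y]) and
    [Dy Ez + sigma Hx = Sx Dy Ez] ([pml_flux_x]).  Multiplying the
    electric field equation on the left by [Ez^* (Px (x) Py)] cancels every [P^-1], and the
    remaining factors [Dx^T], [Dy^T] move onto the left copy of [Ez].  The
    outcome is one complex scalar identity between five quadratic forms of
    [Ez] ([pml_energy_balance]); since [s ^ 2 + sigma s = s ^ 2 Sx], it reads
    [s ^ 2 Sx a + Sx^-1 b + Sx c + s d + sigma e = 0].

    All five forms have real symmetric matrices, hence real values
    ([qform_real]).  Multiplying the identity by [s^* / Sx] makes its
    coefficients [s |s|^2], [s^* / Sx ^ 2], [s^*], [|s|^2 / Sx] and
    [sigma s^* / Sx], whose real parts are those of the energy, so the energy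
    is the real part of zero ([Re_energy]).  Dividing by [Sx] is legitimate
    because [s Sx = s + sigma] has positive real part. *)

Lemma pos_def_unitmx (R : realType) n (P : 'M[R]_n) :
  pos_def P -> P \in unitmx.
Proof.
move=> pP; rewrite unitmxE unitfE; apply/negP => /det0P [v v0 vP].
have := pP v^T; rewrite trmxK vP mul0mx mxE ltxx trmx_eq0.
by move/(_ v0).
Qed.

Lemma diag_trmx (R : realType) n (P : 'M[R]_n) : is_diag_mx P -> P^T = P.
Proof. by case/diag_mxP => d ->; rewrite tr_diag_mx. Qed.

Lemma Bplus_sym (R : realType) n : (Bplus : 'M[R]_n)^T = Bplus.
Proof. by rewrite /Bplus /ER /EL linearD /= !tr_diag_mx. Qed.

Section Kron.
Variables (R : realType) (Nx Ny : nat).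
Implicit Types (A : 'M[R]_Nx) (B : 'M[R]_Ny).
Implicit Types (M N : 'M[R[i]]_(Nx * Ny)) (u : 'cV[R[i]]_(Nx * Ny)).

Lemma kronM A A' B B' :
  kron A B *m kron A' B' = kron (A *m A') (B *m B').
Proof. by rewrite /kron -map_mxM tensmx_mul. Qed.

Lemma kron_adj A B : (kron A B) ^t* = kron A^T B^T.
Proof.
rewrite /kron -trmx_tens; apply/matrixP => i j; rewrite !mxE.
by apply/CrealP/complex_realP; eexists.
Qed.

Lemma qform_mul M N u : qform M (N *m u) = qform (N ^t* *m M *m N) u.
Proof. by rewrite /qform trmx_mul map_mxM !mulmxA. Qed.

Lemma qformD M N u : qform (M + N) u = qform M u + qform N u.
Proof. by rewrite /qform mulmxDr mulmxDl mxE. Qed.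

Lemma qform_real M u : M ^t* = M -> qform M u \is Num.real.
Proof.
move=> hM; apply/CrealP.
have h : (u ^t* *m M *m u) ^t* = u ^t* *m M *m u.
  by rewrite !trmx_mul !map_mxM hM trmxCK mulmxA.
by move: h; rewrite /qform; move: (_ *m u) => X h; rewrite -[in RHS]h !mxE.
Qed.

End Kron.

(** The scalar core of the energy method: [a], ..., [e] stand for the
    quadratic forms, and the hypothesis is the field equation tested with the
    unknown itself.  Its multiple by [s^* / S] has the energy as real part. *)
Lemma Re_energy (C : numClosedFieldType) (s sg a b c d e : C) :
  let S := 1 + sg / s in
  s != 0 -> S != 0 ->
  a \is Num.real -> b \is Num.real -> c \is Num.real -> d \is Num.real ->
  e \is Num.real -> sg \is Num.real ->
  s ^+ 2 * a = - (S^-1 * b) - S * c - sg * s * a - s * d - sg * e ->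
  'Re s * `|s| ^+ 2 * a + (`|S| ^+ 2)^-1 * 'Re ((s * S)^* / S) * b
  + 'Re s * c + `|s| ^+ 2 * 'Re (S^-1) * d + sg * 'Re (s^* / S) * e = 0.
Proof.
move=> S s0 S0 ra rb rc rd re rg eqn.
have rn (x : C) : `|x| ^+ 2 \is Num.real by rewrite rpredX ?normr_real.
have rnV (x : C) : (`|x| ^+ 2)^-1 \is Num.real by rewrite rpredV rn.
have eq0 : s * `|s| ^+ 2 * a + (`|S| ^+ 2)^-1 * ((s * S)^* / S) * b
  + s^* * c + `|s| ^+ 2 * S^-1 * d + sg * (s^* / S) * e = 0.
  have Sc0 : S^* != 0 by rewrite conjC_eq0.
  have -> : s * `|s| ^+ 2 * a =
     s^* / S * (s ^+ 2 * a + sg * s * a).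
    have -> : sg = s * (S - 1) by rewrite /S; field.
    by rewrite normCK; field.
  by rewrite eqn !normCK rmorphM /=; field; rewrite S0.
(* The multiplier puts s^* in front of c, where the energy has s. *)
have -> : 'Re s * c = 'Re (s^*) * c by rewrite Re_conj.
transitivity ('Re (0 : C)); last by rewrite (Creal_ReP 0 _) // rpred0.
rewrite -eq0 !raddfD /=.
by rewrite !(ReMr ra, ReMr rb, ReMr rc, ReMr rd, ReMr re, ReMr (rn s),
  ReMl (rn s), ReMl rg, ReMl (rnV S)).
Qed.

Section PML.
Variables (R : realType) (Nx Ny : nat).
Variables (Px Dx : 'M[R]_Nx) (Py Dy : 'M[R]_Ny).
Variables (sigma : R) (s : R[i]).
Variables (Ez Hy Hx : 'cV[R[i]]_(Nx * Ny)).
Local Notation sg := (real_complex R sigma).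
Local Notation S := (Sx sigma s).
Hypotheses (uPx : Px \in unitmx) (uPy : Py \in unitmx).
Hypotheses (s0 : s != 0) (S0 : S != 0).
Hypothesis sol : pml_solution Px Dx Py Dy sigma 1 s Ez Hy Hx.

(** The damped equation gives [Hy = - Dx Ez / (s + sigma)], where
    [s + sigma = s S]. *)
Lemma pml_flux_y : kron Dx 1%:M *m Ez + sg *: Hy = S^-1 *: (kron Dx 1%:M *m Ez).
Proof.
set U := _ *m Ez.
have eS : s * S = s + sg by rewrite /Sx; field.
have -> : U = - (s * S) *: Hy.
  by rewrite eS scaleNr scalerDl (pml_Hy sol) -/U subrK opprK.
rewrite scalerA -scalerDl; congr (_ *: _).
by rewrite mulrN mulrCA mulVf // mulr1 eS; ring.
Qed.

(** The other magnetic component is undamped, [s Hx = Dy Ez], so here the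
    stretching factor multiplies instead of dividing. *)
Lemma pml_flux_x : kron 1%:M Dy *m Ez + sg *: Hx = S *: (kron 1%:M Dy *m Ez).
Proof.
rewrite -(pml_Hx sol) scalerA -scalerDl; congr (_ *: _).
by rewrite /Sx; field.
Qed.

(** The weak form of the electric field equation, with [Ez] itself as test
    function.  In the inner product of [Px (x) Py] the operators
    [P^-1 D^T P] are the adjoints of the differences [D], and the boundary
    penalties lose their [P^-1]. *)
Lemma pml_energy_balance :
  let P := kron Px Py in
  s ^+ 2 * qform P Ez =
    - (S^-1 * qform P (kron Dx 1%:M *m Ez)) - S * qform P (kron 1%:M Dy *m Ez)
    - sg * s * qform P Ez
    - s * qform (kron Bplus Py + kron Px Bplus) Ez
    - sg * qform (kron Px Bplus) Ez.
Proof.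
move=> P; rewrite qformD !qform_mul !kron_adj !trmx1 /P !kronM !mulmx1 !mul1mx.
pose f (v : 'cV[R[i]]_(Nx * Ny)) := (Ez ^t* *m kron Px Py *m v) 0 0.
have fD u v : f (u + v) = f u + f v by rewrite /f mulmxDr mxE.
have fN v : f (- v) = - f v by rewrite /f mulmxN mxE.
have fB u v : f (u - v) = f u - f v by rewrite fD fN.
have fZ k v : f (k *: v) = k * f v by rewrite /f -scalemxAr mxE.
have fZE k : f (k *: Ez) = k * qform (kron Px Py) Ez by rewrite fZ.
have fZK k A B :
    f (k *: (kron A B *m Ez)) = k * qform (kron (Px *m A) (Py *m B)) Ez.
  by rewrite fZ /f mulmxA -(mulmxA (Ez ^t*)) kronM.
rewrite -fZE (pml_Ez sol).
(* From here on f enters only through its linearity and its values on Ez and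
   on Kronecker products applied to Ez. *)
move: f fD fN fB fZ fZE fZK => f fD fN fB _ fZE fZK.
rewrite pml_flux_x pml_flux_y rmorph1 subrr mulr0 scale0r addr0 mulr1.
rewrite mulmxDl -!scalemxAr !mulmxA !kronM !mul1mx.
rewrite !fB fN fD fZE mulrDr; congr (- _ - _ - _ - (_ + _) - _);
  by rewrite fZK -?mulmxA ?(mulKVmx uPx) ?(mulKVmx uPy) ?mulmx1.
Qed.

End PML.

Theorem theorem5p2 (R : realType) (Nx Ny : nat)
    (Px Qx Dx : 'M[R]_Nx) (Py Qy Dy : 'M[R]_Ny)
    (sigma theta : R) (s : R[i]) (Ez Hy Hx : 'cV[R[i]]_(Nx * Ny)) :
  (2 <= Nx)%N -> (2 <= Ny)%N ->
  sbp_operator Px Qx Dx -> sbp_operator Py Qy Dy ->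
  0 <= sigma -> 0 < 'Re s -> theta = 1 ->
  pml_solution Px Dx Py Dy sigma theta s Ez Hy Hx ->
  pml_energy Px Dx Py Dy sigma theta s Ez = 0.
Proof.
move=> _ _ [dPx pPx _ _] [dPy pPy _ _] sigma0 res theta1; subst theta => sol.
have sg0 : 0 <= real_complex R sigma by rewrite lecR.
have s0 : s != 0.
  by apply: contraTneq res => ->; rewrite (Creal_ReP 0 _) ?rpred0 // ltxx.
have S0 : Sx sigma s != 0.
  (* Otherwise s + sigma = s * Sx = 0, although its real part is positive. *)
  apply: contraTneq (ltr_wpDr sg0 res) => S0.
  have /(congr1 (fun z => 'Re z)) : s + real_complex R sigma = 0.
    by transitivity (s * Sx sigma s); [rewrite /Sx; field | rewrite S0 mulr0].
  rewrite raddfD /= [X in _ + X](Creal_ReP _ _) ?ger0_real // => ->.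
  by rewrite (Creal_ReP 0 _) ?rpred0 // ltxx.
have kron_real (A : 'M_Nx) (B : 'M_Ny) u :
    A^T = A -> B^T = B -> qform (kron A B) u \is Num.real.
  by move=> hA hB; apply: qform_real; rewrite kron_adj hA hB.
have [sPx sPy] := (diag_trmx dPx, diag_trmx dPy).
rewrite /pml_energy rmorph1 mul1r.
have bal :=
  pml_energy_balance (pos_def_unitmx pPx) (pos_def_unitmx pPy) s0 S0 sol.
apply: (Re_energy s0 S0 _ _ _ _ _ _ bal); rewrite ?kron_real ?Bplus_sym //.
  by rewrite qformD rpredD ?kron_real ?Bplus_sym.
exact: ger0_real.
Qed.
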